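(* Let $S$ be a Boolean zero-divisor semigroup with zero element $0$, and let $x\in S$ be nonzero. (1) Let $S_x=\{y\in S : y\neq 0,\ N(y)=N(x)\}$. Then $S_x$ is a sub-semigroup of $S$, and $0\notin S_x$. (2) Let $S_{\leqslant x}=\{y\in S\setminus\{0\} : N(y)\subseteq N(x)\}$. Then $S_{\leqslant x}$ is a sub-semigroup of $S$, $0\notin S_{\leqslant x}$, and $S_x$ is an ideal of $S_{\leqslant x}$.
   Context: All semigroups are commutative, written multiplicatively, and have a zero element $0$ with $0x=0$ for all $x$. A zero-divisor semigroup is such a semigroup $S$ in which every element is a zero-divisor (an element $x$ with $xy=0$ for some nonzero $y\in S$). A semigroup $S$ is Boolean if $r^2=r$ for all $r\in S$. The zero-divisor graph $\Gamma(S)$ is the undirected simple graph whose vertices are the nonzero zero-divisors of $S$ (here: all of $S\setminus\{0\}$), with distinct vertices $x,y$ adjacent if and only if $xy=0$. $N(x)$ is the set of vertices of $\Gamma(S)$ adjacent to $x$. (For this statement, sub-semigroups are not required to contain $0$.) *)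

(* Defs.v *)
From HB Require Import structures.
From mathcomp Require Import all_boot.
From mathcomp Require Import boolp classical_sets.

Set Implicit Arguments.
Unset Strict Implicit.
Unset Printing Implicit Defensive.

Local Open Scope classical_set_scope.
Local Open Scope group_scope.

HB.mixin Record Semigroup_isCommutativeWithZero S of Semigroup S := {
  zero : S;
  mulgC : commutative (@mul S);
  mul0g : left_zero zero (@mul S)
}.

#[short(type="comSemigroup0Type")]
HB.structure Definition ComSemigroup0 :=
  {S of Semigroup_isCommutativeWithZero S & Semigroup S}.

Notation "0" := (@zero _) : group_scope.

Definition zero_divisor (S : comSemigroup0Type) (x : S) : Prop :=
  exists2 y : S, y <> 0 & x * y = 0.

(* Since 0 is itself required to be a zero-divisor, S has a nonzero element. *)
Definition zero_divisor_semigroup (S : comSemigroup0Type) : Prop :=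
  forall x : S, zero_divisor x.

Definition boolean_semigroup (S : comSemigroup0Type) : Prop :=
  idempotent_op (@mul S).

(* The zero-divisor graph Gamma(S), as a vertex set and an adjacency relation
   on S that only relates vertices. *)
Definition Gamma_vertex (S : comSemigroup0Type) : set S :=
  [set x | x <> 0 /\ zero_divisor x].

Definition Gamma_adj (S : comSemigroup0Type) (x y : S) : Prop :=
  [/\ Gamma_vertex x, Gamma_vertex y, x <> y & x * y = 0].

Definition nbhood (S : comSemigroup0Type) (x : S) : set S :=
  [set y | Gamma_adj x y].

(* Sub-semigroups and ideals are nonempty; neither has to contain the zero
   element of S. *)
Definition subsemigroup (S : semigroupType) (A : set S) : Prop :=
  A !=set0 /\ forall x y : S, A x -> A y -> A (x * y).

(* I is an ideal of the semigroup A: absorption is by the elements of A only. *)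
Definition ideal_of (S : semigroupType) (A I : set S) : Prop :=
  [/\ I !=set0, I `<=` A &
      forall a i : S, A a -> I i -> I (a * i) /\ I (i * a)].

Definition nbhood_class (S : comSemigroup0Type) (x : S) : set S :=
  [set y | y <> 0 /\ nbhood y = nbhood x].

Definition nbhood_lower (S : comSemigroup0Type) (x : S) : set S :=
  [set y | y <> 0 /\ nbhood y `<=` nbhood x].

(* Main.v *)
Require Import Defs.
From mathcomp Require Import all_boot.
From mathcomp Require Import boolp classical_sets.

Local Open Scope classical_set_scope.
Local Open Scope group_scope.

(** Idempotence turns neighbourhoods into annihilators: since y * y = y, a
    nonzero y does not annihilate itself, so the neighbours of y are exactly
    the nonzero z with y * z = 0, and inclusion of neighbourhoods is inclusion
    of annihilators ([nbhood_subP]).  The lower set of x thus consists of the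
    nonzero y with ann y contained in ann x.

    If ann a and ann b lie in ann x and a * b * z = 0, then b * z is in ann a,
    hence in ann x; so x * z is in ann b, hence in ann x; and x * x * z = 0 is
    x * z = 0.  Thus ann (a * b) lies in ann x ([ann_sub_mul]).  The product
    a * b is nonzero, as otherwise x would annihilate x * x = x.  Conversely
    ann x is contained in ann (a * i) as soon as it is contained in ann i.
    These facts together say that the class of x is an ideal of the lower set,
    and an ideal is in particular closed under products. *)

Lemma mulg0 (S : comSemigroup0Type) (y : S) : y * 0 = 0.
Proof. by rewrite mulgC mul0g. Qed.

(** As y * y = y is nonzero, every z annihilated by y differs from y. *)
Lemma nbhoodE (S : comSemigroup0Type) (y z : S) :
  zero_divisor_semigroup S -> boolean_semigroup S -> y <> 0 ->
  nbhood y z <-> z <> 0 /\ y * z = 0.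
Proof.
move=> zdS boolS y0; split=> [[_ [z0 _] _ yz0] //|[z0 yz0]].
by split=> // yz; apply: y0; rewrite -(boolS y) {2}yz.
Qed.

(** The element 0, which belongs to no neighbourhood, lies in every
    annihilator, so it does not affect the inclusion. *)
Lemma nbhood_subP (S : comSemigroup0Type) (y x : S) :
  zero_divisor_semigroup S -> boolean_semigroup S -> y <> 0 -> x <> 0 ->
  nbhood y `<=` nbhood x <-> forall z, y * z = 0 -> x * z = 0.
Proof.
move=> zdS boolS y0 x0; split=> [yx z yz0|yx z].
  have [->|z0] := pselect (z = 0); first exact: mulg0.
  by have /nbhoodE[] : nbhood x z by apply/yx/nbhoodE.
by move=> /nbhoodE[]// z0 yz0; apply/nbhoodE => //; split=> //; apply: yx.
Qed.

(** The two hypotheses are used in turn, to replace a and then b by x; the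
    resulting factor x * x collapses to x. *)
Lemma ann_sub_mul (S : comSemigroup0Type) (x a b : S) :
  boolean_semigroup S ->
  (forall z, a * z = 0 -> x * z = 0) -> (forall z, b * z = 0 -> x * z = 0) ->
  forall z, a * b * z = 0 -> x * z = 0.
Proof.
move=> boolS ax bx z; rewrite -mulgA => /ax xbz0.
by rewrite -(boolS x) -mulgA; apply: bx; rewrite mulgA (mulgC b) -mulgA.
Qed.

(** A product of zero-divisors may vanish, but here a * b = 0 would put x in
    ann (a * b), hence in ann x, against x * x = x <> 0. *)
Lemma nbhood_lower_mul (S : comSemigroup0Type) (x a b : S) :
  zero_divisor_semigroup S -> boolean_semigroup S -> x <> 0 ->
  nbhood_lower x a -> nbhood_lower x b -> nbhood_lower x (a * b).
Proof.
move=> zdS boolS x0 [a0 /nbhood_subP ax] [b0 /nbhood_subP bx].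
have abx : forall z, a * b * z = 0 -> x * z = 0.
  by apply: ann_sub_mul => //; [apply: ax | apply: bx].
have ab0 : a * b <> 0.
  by move=> ab0; apply: x0; rewrite -(boolS x); apply: abx; rewrite ab0 mul0g.
by split=> //; apply/nbhood_subP.
Qed.

Lemma nbhood_class_sub_lower (S : comSemigroup0Type) (x : S) :
  nbhood_class x `<=` nbhood_lower x.
Proof. by move=> y [y0 yx]; split=> //; rewrite yx. Qed.

(** Only the inclusion of ann x in ann (a * i) is new, and i alone provides it:
    multiplying by a can only enlarge an annihilator. *)
Lemma nbhood_class_absorb (S : comSemigroup0Type) (x a i : S) :
  zero_divisor_semigroup S -> boolean_semigroup S -> x <> 0 ->
  nbhood_lower x a -> nbhood_class x i -> nbhood_class x (a * i).
Proof.
move=> zdS boolS x0 la ci.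
have [ai0 aix] : nbhood_lower x (a * i).
  by apply: nbhood_lower_mul => //; apply: nbhood_class_sub_lower.
split=> //; apply/seteqP; split=> //; apply/nbhood_subP => // z xz0.
have [i0 ix] := ci.
have xi : nbhood x `<=` nbhood i by rewrite ix.
have iz0 : i * z = 0 by move: z xz0; apply/nbhood_subP.
by rewrite -mulgA iz0 mulg0.
Qed.

Theorem theorem3p2 (S : comSemigroup0Type) (zdS : zero_divisor_semigroup S)
    (boolS : boolean_semigroup S) (x : S) (x_neq0 : x <> 0) :
  (subsemigroup (nbhood_class x) /\ ~ nbhood_class x 0) /\
  [/\ subsemigroup (nbhood_lower x), ~ nbhood_lower x 0 &
      ideal_of (nbhood_lower x) (nbhood_class x)].
Proof.
have class_x : nbhood_class x x by [].
have class_lower := @nbhood_class_sub_lower S x.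
have absorb a i : nbhood_lower x a -> nbhood_class x i ->
  nbhood_class x (a * i) by exact: nbhood_class_absorb.
split; split.
- by split=> [|a b /class_lower]; [exists x | apply: absorb].
- by case.
- split; first by exists x; apply: class_lower.
  by move=> a b; apply: nbhood_lower_mul.
- by case.
- split=> //; first by exists x.
  by move=> a i la ci; split; last rewrite mulgC; apply: absorb.
Qed.
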